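(* Let $\bar\pi \in (0,1/4)$, let $n$ be a positive integer with $n \le 1/(4\bar\pi)$, let $\boldsymbol{q}$ be any probability distribution on $\{1,2\}$, and let $\hat\gamma_\star$ be any estimator, i.e. any real-valued function of a sample path $(x_1,\dots,x_n)\in\{1,2\}^n$. Then there exists a two-state ergodic and reversible Markov chain (transition matrix $\boldsymbol{P}$ on $\{1,2\}$) with spectral gap $\gamma_\star \ge 1/2$ and minimum stationary probability $\pi_\star \ge \bar\pi$ such that, if $(X_t)_{t=1}^n$ is the chain with transition matrix $\boldsymbol{P}$ and initial distribution $X_1\sim\boldsymbol{q}$, then \[ \Pr\bigl[\,|\hat\gamma_\star(X_1,\dots,X_n)-\gamma_\star|\ge 1/8\,\bigr]\ \ge\ 3/8 . \]
   Context: A transition matrix $\boldsymbol{P}$ on $[d]=\{1,\dots,d\}$ is ergodic if it is irreducible and aperiodic; it then has a unique stationary distribution $\boldsymbol{\pi}$, with all $\pi_i>0$. It is reversible if $\pi_iP_{i,j}=\pi_jP_{j,i}$ for all $i,j$. The minimum stationary probability is $\pi_\star=\min_i\pi_i$. The eigenvalues of a reversible ergodic $\boldsymbol{P}$ are real, $1=\lambda_1>\lambda_2\ge\dots\ge\lambda_d>-1$, and the (absolute) spectral gap is $\gamma_\star=1-\max\{\lambda_2,|\lambda_d|\}$. The initial distribution may be any desired distribution and need not be stationary. *)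

(* Defs.v *)
From HB Require Import structures.
From mathcomp Require Import all_boot all_order all_algebra.
From mathcomp Require Import all_classical all_reals all_analysis.

Set Implicit Arguments.
Unset Strict Implicit.
Unset Printing Implicit Defensive.

Import Order.TTheory GRing.Theory Num.Theory.

Local Open Scope classical_set_scope.
Local Open Scope ring_scope.

Definition distribution_vector (R : realType) (d : nat) (q : 'rV[R]_d) : Prop :=
  (forall i, 0 <= q 0 i) /\ \sum_i q 0 i = 1.

Definition transition_matrix (R : realType) (d : nat) (P : 'M[R]_d) : Prop :=
  (forall i j, 0 <= P i j) /\ (forall i, \sum_j P i j = 1).

Definition irreducible_chain (R : realType) (d : nat) (P : 'M[R]_d) : Prop :=
  forall i j, exists k : nat, 0 < (P ^+ k) i j.

Definition return_times (R : realType) (d : nat) (P : 'M[R]_d) (i : 'I_d) :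
  set nat := [set k | (0 < k)%N /\ 0 < (P ^+ k) i i].

Definition is_gcd (S : set nat) (g : nat) : Prop :=
  (forall k, S k -> (g %| k)%N) /\
  (forall h, (forall k, S k -> (h %| k)%N) -> (h %| g)%N).

Definition aperiodic (R : realType) (d : nat) (P : 'M[R]_d) : Prop :=
  forall i, is_gcd (return_times P i) 1.

Definition ergodic (R : realType) (d : nat) (P : 'M[R]_d) : Prop :=
  [/\ transition_matrix P, irreducible_chain P & aperiodic P].

(* For an ergodic P there is exactly one such pi. *)
Definition stationary (R : realType) (d : nat) (P : 'M[R]_d) (pi : 'rV[R]_d) :
  Prop := distribution_vector pi /\ pi *m P = pi.

Definition reversible (R : realType) (d : nat) (P : 'M[R]_d) (pi : 'rV[R]_d) :
  Prop := forall i j, pi 0 i * P i j = pi 0 j * P j i.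

(* The entries of a distribution are at most 1, so the default value 1 does
   not affect the minimum. *)
Definition min_prob (R : realType) (d : nat) (pi : 'rV[R]_d) : R :=
  \big[Order.min/1]_(i < d) pi 0 i.

(* lam lists the eigenvalues of P, all of them real, in nonincreasing order
   and with algebraic multiplicity.  Indices start at 0: lam 0 is the largest
   eigenvalue. *)
Definition is_spectrum (R : realType) (d : nat) (P : 'M[R]_d)
    (lam : 'I_d -> R) : Prop :=
  (forall i j : 'I_d, (i <= j)%N -> lam j <= lam i) /\
  char_poly P = \prod_(i < d) ('X - (lam i)%:P).

(* The size d.+2 makes the second largest eigenvalue meaningful.  The sorted
   spectrum is unique, so gamma is determined by P. *)
Definition is_spectral_gap (R : realType) (d : nat) (P : 'M[R]_d.+2)
    (gamma : R) : Prop :=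
  exists2 lam : 'I_d.+2 -> R, is_spectrum P lam &
    gamma = 1 - Num.max (lam (inord 1)) `|lam ord_max|.

(* Only meaningful when B has nonzero probability. *)
Definition cond_prob (R : realType) (disp : measure_display)
    (T : measurableType disp) (Pr : probability T R) (A B : set T) : R :=
  fine (Pr (A `&` B)) / fine (Pr B).

Definition history (n d : nat) (T : Type) (X : 'I_n -> T -> 'I_d)
    (x : 'I_n -> 'I_d) (s : 'I_n) : set T :=
  [set w | forall u : 'I_n, (u <= s)%N -> X u w = x u].

(* The times 1, ..., n and the states 1, ..., d are encoded as 0, ..., n-1 and
   0, ..., d-1.  The first clause is measurability of each X t for the discrete
   sigma-algebra on 'I_d. *)
Definition markov_chain (R : realType) (n d : nat) (disp : measure_display)
    (T : measurableType disp) (Pr : probability T R)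
    (q : 'rV[R]_d) (P : 'M[R]_d) (X : 'I_n -> T -> 'I_d) : Prop :=
  [/\ forall t i, measurable (X t @^-1` [set i]),
      forall (t : 'I_n) i, t = 0%N :> nat ->
        Pr (X t @^-1` [set i]) = (q 0 i)%:E &
      forall (s t : 'I_n) (x : 'I_n -> 'I_d), t = s.+1 :> nat ->
        Pr (history X x s) != 0%E ->
        cond_prob Pr (X t @^-1` [set x t]) (history X x s) = P (x s) (x t)].

(* Main.v *)
Require Import Defs.
From HB Require Import structures.
From mathcomp Require Import all_boot all_order all_algebra.
From mathcomp Require Import all_classical all_reals all_analysis.
From mathcomp Require Import ring lra.
Set Implicit Arguments.
Unset Strict Implicit.
Unset Printing Implicit Defensive.
Import Order.TTheory GRing.Theory Num.Theory.
Local Open Scope classical_set_scope.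
Local Open Scope ring_scope.

(** Two chains that behave identically while they sit in a common state, but
    have gaps more than 1/4 apart, cannot be told apart by an estimator that has
    only seen that state.  Let [a] be a state with initial probability at least
    1/2, and let the chain leave [a] with probability [pibar] at each step.  The
    probability of never leaving [a] is at least
    [1/2 * (1 - pibar)^(n-1) >= 1/2 * (1 - n * pibar) >= 3/8], by Bernoulli's
    inequality ([Bernoulli_inequality], [prob_stay]), whatever the probability
    [s] of coming back to [a] is.

    The return probability is what the gap depends on: the eigenvalues are [1]
    and [1 - pibar - s], so for [pibar + s <= 1] the gap is [pibar + s]
    ([two_state_gap]).  Taking [s = 1 - pibar] gives gap [1] and [s = 1/2] gives
    gap [1/2 + pibar < 3/4].  On the constant path the estimator returns one
    fixed number, which lies at distance at least 1/8 from one of the two gaps;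
    the corresponding chain is the required one.

    In both chains the stationary probabilities [pibar / (pibar + s)] and
    [s / (pibar + s)] are at least [pibar], because [pibar <= s] and
    [pibar + s <= 1] ([two_state_min_prob]). *)

(** * Two-state chains *)

(** The parameter [a] avoids fixing a labelling of the states: it will be the
    state that the initial distribution favours. *)
Definition two_state (R : realType) (a : 'I_2) (p s : R) : 'M[R]_2 :=
  \matrix_(i, j) if i == a then (if j == a then 1 - p else p)
                 else (if j == a then s else 1 - s).

Definition two_state_stat (R : realType) (a : 'I_2) (p s : R) : 'rV[R]_2 :=
  \row_j (if j == a then s / (p + s) else p / (p + s)).

Lemma ord2P (i : 'I_2) : i = ord0 \/ i = lift ord0 ord0.
Proof. by case: i => -[|[|//]] Hi; [left|right]; apply/val_inj. Qed.

Lemma sum_ord2 (V : nmodType) (F : 'I_2 -> V) :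
  \sum_i F i = F ord0 + F (lift ord0 ord0).
Proof. by rewrite !big_ord_recl big_ord0 addr0. Qed.

(** Positive entries give one-step access between all states, hence
    irreducibility, and one-step returns, hence period 1. *)
Lemma ergodic_pos (R : realType) (d : nat) (P : 'M[R]_d) :
  transition_matrix P -> (forall i j, 0 < P i j) -> ergodic P.
Proof.
move=> tP Ppos; split=> // [i j|i]; first by exists 1%N; rewrite expr1.
split=> [k _|h]; first exact: dvd1n.
by apply; split=> //; rewrite expr1.
Qed.

(** Detailed balance, summed over the source state. *)
Lemma reversible_stationary (R : realType) (d : nat) (P : 'M[R]_d) (pi : 'rV[R]_d) :
  transition_matrix P -> distribution_vector pi -> reversible P pi ->
  stationary P pi.
Proof.
move=> [_ P1] dpi rev; split=> //; apply/rowP => j; rewrite mxE.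
under eq_bigr do rewrite rev.
by rewrite -mulr_sumr P1 mulr1.
Qed.

Section TwoState.
Variables (R : realType) (a : 'I_2) (p s : R).
Hypotheses (p_gt0 : 0 < p) (p_lt1 : p < 1) (s_gt0 : 0 < s) (s_lt1 : s < 1).

Lemma two_state_ergodic : ergodic (two_state a p s).
Proof.
have Ppos i j : 0 < two_state a p s i j.
  by rewrite mxE; case: eqP => _; case: eqP => _; rewrite ?subr_gt0.
apply: ergodic_pos => //; split=> [i j|i]; first exact: ltW.
rewrite sum_ord2 !mxE.
by case: (ord2P a) => ->; case: (ord2P i) => -> /=; lra.
Qed.

Lemma two_state_reversible :
  reversible (two_state a p s) (two_state_stat a p s).
Proof.
by move=> i j; rewrite !mxE; case: eqP => _; case: eqP => _ //; ring.
Qed.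

Lemma two_state_stationary :
  stationary (two_state a p s) (two_state_stat a p s).
Proof.
have ps_gt0 : 0 < p + s by rewrite addr_gt0.
apply: reversible_stationary two_state_reversible; first by case: two_state_ergodic.
split=> [i|].
  by rewrite mxE; case: eqP => _; rewrite divr_ge0 ?ltW.
rewrite sum_ord2 !mxE.
by case: (ord2P a) => -> /=; field; rewrite gt_eqF.
Qed.

Lemma char_poly_two_state :
  char_poly (two_state a p s) = ('X - 1%:P) * ('X - (1 - p - s)%:P).
Proof.
rewrite /char_poly (expand_det_row _ ord0) sum_ord2 /cofactor !det_mx11 !mxE.
by case: (ord2P a) => -> /=; rewrite !(polyCB, polyC1); ring.
Qed.

Lemma two_state_gap : p + s <= 1 ->
  is_spectral_gap (two_state a p s) (p + s).
Proof.
move=> ps_le1; have lam_le1 : 1 - p - s <= 1.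
  by rewrite -addrA gerDl -opprD oppr_le0 ltW // addr_gt0.
exists (fun i : 'I_2 => if i == ord0 then 1 else 1 - p - s).
  split=> [i j|]; last first.
    by rewrite char_poly_two_state !big_ord_recl big_ord0 mulr1.
  by case: (ord2P i) => ->; case: (ord2P j) => -> //=.
rewrite -val_eqE /= inordK //= ger0_norm; last by lra.
by rewrite maxxx; lra.
Qed.

Lemma two_state_min_prob : p <= s -> p + s <= 1 ->
  p <= min_prob (two_state_stat a p s).
Proof.
move=> ps ps_le1; have ps_gt0 : 0 < p + s by rewrite addr_gt0.
have le_div (x : R) : 0 < x -> x <= x / (p + s).
  by move=> x0; rewrite ler_pdivlMr // ler_piMr // ltW.
rewrite /min_prob; apply: (big_ind (fun x => p <= x)) => [|x y px py|i _]; first exact: ltW.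
  by rewrite le_min px.
rewrite mxE; case: eqP => _; last exact: le_div.
by apply: le_trans ps _; exact: le_div.
Qed.

End TwoState.

(** * Staying in one state *)

Lemma Bernoulli_inequality (R : realDomainType) (x : R) (k : nat) :
  x <= 1 -> 1 - k%:R * x <= (1 - x) ^+ k.
Proof.
move=> x1; elim: k => [|k IH]; first by rewrite mul0r subr0 expr0.
rewrite exprSr; apply: (@le_trans _ _ ((1 - k%:R * x) * (1 - x))); last first.
  by rewrite ler_wpM2r // subr_ge0.
by rewrite -natr1; have := mulr_ge0 (ler0n R k) (sqr_ge0 x); nra.
Qed.

Section Paths.
Variables (R : realType) (n d : nat) (disp : measure_display).
Variables (T : measurableType disp) (Pr : probability T R).
Variables (q : 'rV[R]_d) (P : 'M[R]_d) (X : 'I_n -> T -> 'I_d).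
Hypothesis chainX : markov_chain Pr q P X.

Lemma measurable_history x s : measurable (history X x s).
Proof.
case: chainX => mX _ _.
have -> : history X x s =
    \bigcap_(u in [set u : 'I_n | (u <= s)%N]) (X u @^-1` [set x u]).
  by apply/seteqP; split=> w /=.
by apply: fin_bigcap_measurable => // u _; exact: mX.
Qed.

(** Only finitely many sample paths exist, so every event that depends on the
    path alone is a finite union of cylinders. *)
Lemma measurable_path_event (A : n.-tuple 'I_d -> Prop) :
  measurable [set w | A [tuple X t w | t < n]].
Proof.
case: chainX => mX _ _.
have -> : [set w | A [tuple X t w | t < n]] =
    \bigcup_(x in [set x : n.-tuple 'I_d | A x])
      \bigcap_(u in [set: 'I_n]) (X u @^-1` [set tnth x u]).
  apply/seteqP; split=> w /=.
    by move=> Aw; exists [tuple X t w | t < n] => // u _ /=; rewrite tnth_mktuple.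
  case=> x Ax xw; suff -> : [tuple X t w | t < n] = x by [].
  by apply: eq_from_tnth => u; rewrite tnth_mktuple; exact: xw.
apply: fin_bigcup_measurable => // x _.
by apply: fin_bigcap_measurable => // u _; exact: mX.
Qed.

(** Conditioning on the next state along the constant history multiplies the
    probability by [P a a].  The two positivity hypotheses keep every history
    non-null, so that the Markov property can be applied at each step. *)
Lemma prob_stay (a : 'I_d) (t : 'I_n) : 0 < q 0 a -> 0 < P a a ->
  Pr (history X (fun=> a) t) = (q 0 a * P a a ^+ t)%:E.
Proof.
case: chainX => mX X0 XS qa Pa.
case: t => k; elim: k => [|k IH] kn.
  rewrite /= expr0 mulr1 -(X0 (Ordinal kn)) //; congr (Pr _).
  apply/seteqP; split=> w /=; first by apply.
  by move=> Xa u; rewrite leqn0 => /eqP u0; rewrite -Xa; congr X; exact/val_inj.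
have {}IH := IH (ltnW kn).
set s := Ordinal (ltnW kn) in IH *; set t := Ordinal kn.
have Hs0 : Pr (history X (fun=> a) s) != 0%E.
  by rewrite IH eqe gt_eqF // mulr_gt0 // exprn_gt0.
have := XS s t (fun=> a) erefl Hs0; rewrite /cond_prob IH /=.
have -> : X t @^-1` [set a] `&` history X (fun=> a) s = history X (fun=> a) t.
  apply/seteqP; split=> w /=.
    case=> Xt Xs u; rewrite leq_eqVlt => /orP[/eqP ut|us]; last exact: Xs.
    by rewrite -Xt; congr X; exact/val_inj.
  by move=> Xt; split=> [|u us]; apply: Xt => //=; exact: leqW.
move=> /(canRL (divfK _)) Hfine.
rewrite -[LHS]fineK; last first.
  by apply: fin_num_measure; exact: measurable_history.
rewrite Hfine; first by rewrite exprS mulrCA.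
by rewrite mulf_neq0 ?expf_neq0 ?gt_eqF.
Qed.

Lemma prob_constant_path (a : 'I_d) (A : n.-tuple 'I_d -> Prop) :
  (0 < n)%N -> 0 < q 0 a -> 0 < P a a -> A [tuple a | _ < n] ->
  ((q 0 a * P a a ^+ n.-1)%:E <= Pr [set w | A [tuple X t w | t < n]])%E.
Proof.
move=> n_gt0 qa Pa Aa.
have n1n : (n.-1 < n)%N by rewrite prednK.
rewrite -(@prob_stay a (Ordinal n1n)) //.
apply: le_measure; rewrite ?inE; [exact: measurable_history| |move=> w /= Xa].
  exact: measurable_path_event.
suff -> : [tuple X t w | t < n] = [tuple a | _ < n] by [].
apply: eq_from_tnth => u; rewrite !tnth_mktuple; apply: Xa => /=.
by rewrite -ltnS prednK.
Qed.

End Paths.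

(** * Two indistinguishable chains *)

Lemma distribution_has_half (R : realType) (q : 'rV[R]_2) :
  distribution_vector q -> exists a, 1 / 2 <= q 0 a.
Proof.
case=> _; rewrite sum_ord2 => q1.
have [|lt0] := leP (1 / 2) (q 0 ord0); first by exists ord0.
by exists (lift ord0 ord0); lra.
Qed.

Theorem theorem3p1 (R : realType) (pibar : R) (n : nat) (q : 'rV[R]_2)
    (gammahat : n.-tuple 'I_2 -> R)
    (pibar_gt0 : 0 < pibar) (pibar_lt : pibar < 1 / 4)
    (n_gt0 : (0 < n)%N) (n_le : n%:R <= 1 / (4 * pibar))
    (q_distr : distribution_vector q) :
  exists (P : 'M[R]_2) (pi : 'rV[R]_2) (gamma : R),
    [/\ ergodic P, stationary P pi & reversible P pi] /\
    [/\ is_spectral_gap P gamma, 1 / 2 <= gamma & pibar <= min_prob pi] /\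
    forall (disp : measure_display) (T : measurableType disp)
      (Pr : probability T R) (X : 'I_n -> T -> 'I_2),
      markov_chain Pr q P X ->
      ((3 / 8)%:E <=
         Pr [set w | (1 / 8 <= `|gammahat [tuple X t w | t < n] - gamma|)%R])%E.
Proof.
have [a qa] := distribution_has_half q_distr.
have stay_ge : 3 / 8 <= q 0 a * (1 - pibar) ^+ n.-1.
  have n1_le : n.-1%:R * pibar <= 1 / 4.
    have : n%:R * pibar <= 1 / 4.
      have -> : 1 / 4 = 1 / (4 * pibar) * pibar by field; rewrite gt_eqF.
      by rewrite ler_pM2r.
    by apply: le_trans; rewrite ler_pM2r // ler_nat leq_pred.
  have := @Bernoulli_inequality R pibar n.-1; move=> /(_ ltac:(lra)) B.
  have -> : 3 / 8 = 1 / 2 * (3 / 4) :> R by field.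
  by apply: ler_pM => //; lra.
have [s [s_ge s_lt1 ps_le1 far]] : exists s, [/\ 1 / 2 <= s, s < 1,
    pibar + s <= 1 & 1 / 8 <= `|gammahat [tuple a | _ < n] - (pibar + s)|].
  have [far|near] := leP (1 / 8) `|gammahat [tuple a | _ < n] - 1|.
    exists (1 - pibar); have -> : pibar + (1 - pibar) = 1 by ring.
    by split=> //; lra.
  exists (1 / 2); split; [lra|lra|lra|].
  (* An estimate within 1/8 of [1] exceeds 7/8, while [pibar + 1/2 < 3/4]. *)
  by move: near; rewrite ltr_norml => /andP[near _]; rewrite ler_normr; lra.
have [p_lt1 s_gt0] : pibar < 1 /\ 0 < s by split; lra.
exists (two_state a pibar s), (two_state_stat a pibar s), (pibar + s).
split; [split|split; [split|]].
- exact: two_state_ergodic.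
- exact: two_state_stationary.
- exact: two_state_reversible.
- exact: two_state_gap.
- lra.
- by apply: two_state_min_prob => //; lra.
move=> disp T Pr X chainX.
have Paa : two_state a pibar s a a = 1 - pibar by rewrite mxE eqxx.
apply: (@le_trans _ _ (q 0 a * two_state a pibar s a a ^+ n.-1)%:E).
  by rewrite lee_fin Paa.
apply: (prob_constant_path chainX
  (A := fun x => 1 / 8 <= `|gammahat x - (pibar + s)|)) => //; last first.
  by rewrite Paa; lra.
by lra.
Qed.
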